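(* Let $\mathtt T$ be a monad on a set $\mathcal X$ and $\mathtt J$ a left ideal of $\mathtt T$. Regard $\mathtt T/\mathtt J$ as a $(\mathtt T,\mathrm E_{\mathtt T}(\mathtt J))$-bimodule. (1) There is an adjunction between left modules $$\mathtt T/\mathtt J\otimes_{\mathrm E_{\mathtt T}(\mathtt J)}(-):\mathrm E_{\mathtt T}(\mathtt J)\text{-}\mathsf{Mod}\rightleftarrows\mathtt T\text{-}\mathsf{Mod}:\mathrm{Hom}^{\mathrm L}_{\mathtt T}(\mathtt T/\mathtt J,-),$$ the tensor functor being left adjoint. (2) There is an adjunction between right modules $$(-)\otimes_{\mathtt T}\mathtt T/\mathtt J:\mathsf{Mod}\text{-}\mathtt T\rightleftarrows\mathsf{Mod}\text{-}\mathrm E_{\mathtt T}(\mathtt J):\mathrm{Hom}^{\mathrm R}_{\mathrm E_{\mathtt T}(\mathtt J)}(\mathtt T/\mathtt J,-),$$ the tensor functor being left adjoint.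
   Context: $\Bbbk$ is a fixed commutative unital ring. A monad $\mathtt T$ on a set $\mathcal X$ (in the bicategory of matrices of $\Bbbk$-modules) is a family of $\Bbbk$-modules $\mathtt T(Y,X)$ ($X,Y\in\mathcal X$) with associative bilinear composition $\mathtt T(Z,Y)\otimes\mathtt T(Y,X)\to\mathtt T(Z,X)$, $(g,f)\mapsto g\circ f$, and units $1_X\in\mathtt T(X,X)$ (equivalently a $\Bbbk$-linear category with object set $\mathcal X$). A left $\mathtt T$-module is a family $\mathtt M(X)$ with associative unital actions $\mathtt T(Y,X)\otimes\mathtt M(X)\to\mathtt M(Y)$; a right $\mathtt T$-module is a family $\mathtt N(X)$ with actions $\mathtt N(Y)\otimes\mathtt T(Y,X)\to\mathtt N(X)$; $\mathtt T\text{-}\mathsf{Mod}$ and $\mathsf{Mod}\text{-}\mathtt T$ are the categories of these. For monads $\mathtt T,\mathtt S$ on $\mathcal X,\mathcal Y$, a $(\mathtt T,\mathtt S)$-bimodule is a family $\mathtt B(X,Y)$ with commuting left $\mathtt T$- and right $\mathtt S$-actions $\mathtt T(X',X)\otimes\mathtt B(X,Y)\to\mathtt B(X',Y)$, $\mathtt B(X,Y)\otimes\mathtt S(Y,Y')\to\mathtt B(X,Y')$. Balanced tensor products: $(\mathtt B\otimes_{\mathtt S}\mathtt N)(X)$ is $\bigoplus_Y\mathtt B(X,Y)\otimes\mathtt N(Y)$ modulo $(b\lhd s)\otimes v-b\otimes(s\rhd v)$, and similarly for right modules. Internal homs: $\mathrm{Hom}^{\mathrm L}_{\mathtt T}(\mathtt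 B,\mathtt M)(Y)$ is the $\Bbbk$-module of left $\mathtt T$-module maps $\mathtt B(-,Y)\to\mathtt M$, a left $\mathtt S$-module by $(s\rhd\varphi)(b)=\varphi(b\lhd s)$; $\mathrm{Hom}^{\mathrm R}_{\mathtt S}(\mathtt B,\mathtt N)(X)$ is the $\Bbbk$-module of right $\mathtt S$-module maps $\mathtt B(X,-)\to\mathtt N$, a right $\mathtt T$-module by $(\varphi\lhd t)(b)=\varphi(t\rhd b)$. A left ideal $\mathtt J\subset\mathtt T$ is a family of submodules $\mathtt J(Y,X)\subset\mathtt T(Y,X)$ with $\mathtt T\circ\mathtt J\subset\mathtt J$. Its idealizer is the submonad $\mathrm{Iz}_{\mathtt T}(\mathtt J)(Y,X)=\{f\in\mathtt T(Y,X):\mathtt J(Z,Y)\circ f\subset\mathtt J(Z,X)\ \forall Z\in\mathcal X\}$, which contains $\mathtt J$ as a two-sided ideal; the eigenmonad is $\mathrm E_{\mathtt T}(\mathtt J)=\mathrm{Iz}_{\mathtt T}(\mathtt J)/\mathtt J$. The bimodule structure on $\mathtt T/\mathtt J$ is induced by composition in $\mathtt T$. *)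

(* Defs.v *)
From HB Require Import structures.
From mathcomp Require Import all_boot all_algebra.
From mathcomp Require Import generic_quotient ring_quotient.
From mathcomp Require Import boolp classical_sets functions cardinality fsbigop.

Set Implicit Arguments.
Unset Strict Implicit.
Unset Printing Implicit Defensive.

Import GRing.Theory.
Local Open Scope ring_scope.

(* [{bilinear _ -> _ -> _}] is only available over nontrivial rings. *)
Definition bilin (k : pzRingType) (U V W : lmodType k) (f : U -> V -> W) : Prop :=
  (forall u, linear (f u)) /\ (forall v, linear (f^~ v)).

Section LinearFun.
Variables (k : pzRingType) (U V : lmodType k) (f : U -> V).

Definition lin_of (lf : linear f) : {linear U -> V} :=
  HB.pack_for {linear U -> V} f (GRing.isLinear.Build k U V *:%R f lf).

Hypothesis lf : linear f.
Lemma lin0 : f 0 = 0. Proof. exact: (raddf0 (lin_of lf)). Qed.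
Lemma linD u v : f (u + v) = f u + f v. Proof. exact: (raddfD (lin_of lf)). Qed.
Lemma linB u v : f (u - v) = f u - f v. Proof. exact: (raddfB (lin_of lf)). Qed.
Lemma linZ a u : f (a *: u) = a *: f u. Proof. exact: (scalable_linear lf). Qed.
End LinearFun.

Section Bilin.
Variables (k : pzRingType) (U V W : lmodType k) (f : U -> V -> W).
Hypothesis bf : bilin f.
Lemma bilinP a u u' v : f (a *: u + u') v = a *: f u v + f u' v.
Proof. exact: bf.2. Qed.
Lemma bilinPr u a v v' : f u (a *: v + v') = a *: f u v + f u v'.
Proof. exact: bf.1. Qed.
Lemma bilin0l v : f 0 v = 0. Proof. exact: (lin0 (bf.2 v)). Qed.
Lemma bilin0r u : f u 0 = 0. Proof. exact: (lin0 (bf.1 u)). Qed.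
Lemma bilinBl u u' v : f (u - u') v = f u v - f u' v.
Proof. exact: (linB (bf.2 v)). Qed.
Lemma bilinBr u v v' : f u (v - v') = f u v - f u v'.
Proof. exact: (linB (bf.1 u)). Qed.
End Bilin.

Section Submodule.
Variables (k : pzRingType) (V : lmodType k) (S : submodClosed V).

Definition submod : Type := {v : V | v \in S}.
HB.instance Definition _ := SubChoice.on submod.
HB.instance Definition _ := [SubChoice_isSubLmodule of submod by <:].

Definition in_submod (v : V) (Sv : v \in S) : submod := exist _ v Sv.

Lemma submod_oppr_closed : oppr_closed S.
Proof. by move=> v Sv; rewrite -scaleN1r; apply: rpredZ. Qed.

Definition submod_zmodClosed : zmodClosed V :=
  HB.pack_for (zmodClosed V) (GRing.SubmodClosed.sort S)
    (GRing.isOppClosed.Build V (GRing.SubmodClosed.sort S) submod_oppr_closed).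

Lemma submodN v : v \in S -> - v \in S. Proof. exact: submod_oppr_closed. Qed.
Lemma submodB u v : u \in S -> v \in S -> u - v \in S.
Proof. by move=> Su Sv; rewrite rpredD ?submodN. Qed.

Definition qmod : Type := Quotient.quot submod_zmodClosed.
HB.instance Definition _ := GRing.Zmodule.on qmod.

Definition qproj (v : V) : qmod := \pi_(Quotient.quot submod_zmodClosed)%qT v.
Definition qrepr (q : qmod) : V := repr (q : Quotient.quot submod_zmodClosed).

Lemma qreprK q : qproj (qrepr q) = q.
Proof. exact: reprK. Qed.

Lemma qprojP u v : (qproj u = qproj v) <-> (u - v \in S).
Proof.
have := Quotient.idealrBE submod_zmodClosed u v.
by move=> E; split=> [/eqP|H]; [rewrite -E | apply/eqP; rewrite -E].
Qed.

Lemma qprojD u v : qproj (u + v) = qproj u + qproj v.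
Proof. exact: Quotient.pi_add. Qed.

Definition qscale (a : k) (q : qmod) : qmod := qproj (a *: qrepr q).

Lemma qprojZ a v : qproj (a *: v) = qscale a (qproj v).
Proof.
apply/qprojP; rewrite -scalerBr; apply: rpredZ.
by apply/qprojP; rewrite qreprK.
Qed.

Fact qscalerA a b q : qscale a (qscale b q) = qscale (a * b) q.
Proof. by rewrite -[q]qreprK -!qprojZ scalerA. Qed.
Fact qscale1r : left_id 1 qscale.
Proof. by move=> q; rewrite -[q in LHS]qreprK -qprojZ scale1r qreprK. Qed.
Fact qscalerDr : right_distributive qscale +%R.
Proof.
by move=> a p q; rewrite -[p]qreprK -[q]qreprK -qprojD -!qprojZ -qprojD scalerDr.
Qed.
Fact qscalerDl q : {morph qscale^~ q : a b / a + b}.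
Proof. by move=> a b; rewrite -[q]qreprK -!qprojZ -qprojD scalerDl. Qed.

HB.instance Definition _ :=
  GRing.Zmodule_isLmodule.Build k qmod qscalerA qscale1r qscalerDr qscalerDl.

Lemma qproj_linear : linear qproj.
Proof. by move=> a u v; rewrite qprojD qprojZ. Qed.

Lemma qproj0 v : v \in S -> qproj v = 0.
Proof.
by move=> Sv; rewrite -(lin0 qproj_linear); apply/qprojP; rewrite subr0.
Qed.

Lemma qmod_ind (P : qmod -> Prop) : (forall v, P (qproj v)) -> forall q, P q.
Proof. by move=> H q; rewrite -[q]qreprK. Qed.

(* Maps out of a quotient: [f] is expected to be linear and to vanish on [S]. *)
Definition qlift (W : lmodType k) (f : V -> W) (q : qmod) : W := f (qrepr q).

Lemma qliftE (W : lmodType k) (f : V -> W) (lf : linear f)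
  (f0 : forall v, v \in S -> f v = 0) v : qlift f (qproj v) = f v.
Proof.
apply/eqP; rewrite -subr_eq0 -(linB lf) f0 //.
by apply/qprojP; rewrite qreprK.
Qed.

Lemma qlift_linear (W : lmodType k) (f : V -> W) (lf : linear f)
  (f0 : forall v, v \in S -> f v = 0) : linear (qlift f).
Proof.
move=> a; elim/qmod_ind=> u; elim/qmod_ind=> v.
by rewrite -qproj_linear !qliftE // lf.
Qed.

End Submodule.

Section Span.
Variables (k : pzRingType) (V : lmodType k) (A : V -> Prop).

(* The submodule generated by [A], as an intersection. *)
Definition span : {pred V} := fun x =>
  `[< forall S : submodClosed V, (forall a, A a -> a \in S) -> x \in S >].

Fact span_closed : subsemimod_closed span.
Proof.
split; first split.
- by apply/asboolP => S _; apply: rpred0.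
- move=> x y /asboolP xS /asboolP yS; apply/asboolP => S AS.
  by apply: rpredD; [apply: xS | apply: yS].
- by move=> a x /asboolP xS; apply/asboolP => S AS; apply/rpredZ/xS.
Qed.

HB.instance Definition _ := GRing.isSubSemiModClosed.Build k V span span_closed.

Lemma span_gen a : A a -> a \in span.
Proof. by move=> Aa; apply/asboolP => S; apply. Qed.

Lemma span_min (S : submodClosed V) :
  (forall a, A a -> a \in S) -> forall x, x \in span -> x \in S.
Proof. by move=> AS x /asboolP; apply. Qed.

End Span.

Section Kernel.
Variables (k : pzRingType) (V W : lmodType k) (f : V -> W).

Definition linker (lf : linear f) : {pred V} := fun v => f v == 0.
Variable lf : linear f.

Fact linker_closed : subsemimod_closed (linker lf).
Proof.
split; first split.
- by rewrite unfold_in /linker (lin0 lf).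
- move=> x y; rewrite !unfold_in /linker (linD lf) => /eqP-> /eqP->.
  by rewrite addr0.
- by move=> a x; rewrite !unfold_in /linker (linZ lf) => /eqP->; rewrite scaler0.
Qed.
HB.instance Definition _ :=
  GRing.isSubSemiModClosed.Build k V (linker lf) linker_closed.

Lemma span_ker (A : V -> Prop) :
  (forall a, A a -> f a = 0) -> forall x, x \in span A -> f x = 0.
Proof.
move=> A0 x xA; apply/eqP.
apply: (@span_min k V A (linker lf : submodClosed V)) xA => a /A0 fa.
by rewrite unfold_in /linker fa.
Qed.
End Kernel.

Section DirectSum.
Variables (k : pzRingType) (I : Type) (V : I -> lmodType k).

Definition dprod : Type := forall i, V i.
HB.instance Definition _ := gen_eqMixin dprod.
HB.instance Definition _ := gen_choiceMixin dprod.

Fact dprod_addA : associative (fun (f g : dprod) => (fun i => f i + g i) : dprod).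
Proof. by move=> f g h; apply: functional_extensionality_dep => i; rewrite addrA. Qed.
Fact dprod_addC : commutative (fun (f g : dprod) => (fun i => f i + g i) : dprod).
Proof. by move=> f g; apply: functional_extensionality_dep => i; rewrite addrC. Qed.
Fact dprod_add0 :
  left_id ((fun=> 0) : dprod) (fun (f g : dprod) => (fun i => f i + g i) : dprod).
Proof. by move=> f; apply: functional_extensionality_dep => i; rewrite add0r. Qed.
Fact dprod_addN : left_inverse ((fun=> 0) : dprod)
  (fun f : dprod => (fun i => - f i) : dprod)
  (fun (f g : dprod) => (fun i => f i + g i) : dprod).
Proof. by move=> f; apply: functional_extensionality_dep => i; rewrite addNr. Qed.
HB.instance Definition _ :=
  GRing.isZmodule.Build dprod dprod_addA dprod_addC dprod_add0 dprod_addN.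

Definition dprod_scale (a : k) (f : dprod) : dprod := fun i => a *: f i.
Fact dprod_scaleA a b f : dprod_scale a (dprod_scale b f) = dprod_scale (a * b) f.
Proof. by apply: functional_extensionality_dep => i; rewrite /dprod_scale scalerA. Qed.
Fact dprod_scale1 : left_id 1 dprod_scale.
Proof.
by move=> f; apply: functional_extensionality_dep => i; rewrite /dprod_scale scale1r.
Qed.
Fact dprod_scaleDr : right_distributive dprod_scale +%R.
Proof.
by move=> a f g; apply: functional_extensionality_dep => i; apply: scalerDr.
Qed.
Fact dprod_scaleDl f : {morph dprod_scale^~ f : a b / a + b}.
Proof.
by move=> a b; apply: functional_extensionality_dep => i; apply: scalerDl.
Qed.
HB.instance Definition _ := GRing.Zmodule_isLmodule.Build k dprod
  dprod_scaleA dprod_scale1 dprod_scaleDr dprod_scaleDl.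

Definition dsupp (f : dprod) : set I := [set i | f i <> 0]%classic.
Definition finsupp : {pred dprod} := fun f => `[< finite_set (dsupp f) >].

Fact finsupp_closed : subsemimod_closed finsupp.
Proof.
split; first split.
- by apply/asboolP; apply: (sub_finite_set _ (@finite_set0 I)) => i.
- move=> f g /asboolP ff /asboolP fg; apply/asboolP.
  have /sub_finite_set : (dsupp (f + g) `<=` dsupp f `|` dsupp g)%classic.
    move=> i /= fgi; have [fi|fi] := pselect (f i = 0); last by left.
    right=> gi; apply: fgi; rewrite -[(f + g) i]/(f i + g i).
    by rewrite fi gi addr0.
  by apply; rewrite finite_setU.
- move=> a f /asboolP ff; apply/asboolP; apply: sub_finite_set ff => i /= afi fi.
  by apply: afi; rewrite -[(a *: f) i]/(a *: f i) fi scaler0.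
Qed.
HB.instance Definition _ :=
  GRing.isSubSemiModClosed.Build k dprod finsupp finsupp_closed.

Definition dsum : Type := submod finsupp.
HB.instance Definition _ := GRing.Lmodule.on dsum.

Definition dsum_fun (f : dsum) : forall i, V i := val f.

Lemma dsum_fun_linear i : linear (fun f => dsum_fun f i).
Proof. by []. Qed.

Lemma dsum_ext (f g : dsum) : (forall i, dsum_fun f i = dsum_fun g i) -> f = g.
Proof.
by move=> fg; apply: val_inj; apply: functional_extensionality_dep => i.
Qed.

Definition dprod_in i (v : V i) : dprod := fun j =>
  if pselect (i = j) is left e then eq_rect i (fun l => V l : Type) v j e else 0.

Lemma dprod_inE i (v : V i) : dprod_in v i = v.
Proof.
rewrite /dprod_in; case: pselect => // e.
by rewrite (Prop_irrelevance e erefl).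
Qed.

Lemma dprod_in_neq i j (v : V i) : i <> j -> dprod_in v j = 0.
Proof. by rewrite /dprod_in => ij; case: pselect. Qed.

Fact dprod_in_finsupp i (v : V i) : dprod_in v \in finsupp.
Proof.
apply/asboolP; apply: (sub_finite_set _ (finite_set1 i)) => j /= H.
by have [//|ij] := pselect (j = i); case: H; apply: dprod_in_neq => /esym.
Qed.

Definition dsum_in i (v : V i) : dsum :=
  in_submod (dprod_in_finsupp v).

Lemma dsum_in_linear i : linear (@dsum_in i).
Proof.
move=> a u v; apply: dsum_ext => j; rewrite dsum_fun_linear /dsum_fun /=.
have [<-|ij] := pselect (i = j); first by rewrite !dprod_inE.
by rewrite !dprod_in_neq // scaler0 addr0.
Qed.

Lemma dsum_decomp (f : dsum) (s : seq {classic I}) : uniq s ->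
  (forall i : {classic I}, dsum_fun f i <> 0 -> i \in s) ->
  f = \sum_(i <- s) dsum_in (dsum_fun f i).
Proof.
move=> us fs; apply: dsum_ext => j.
have -> : dsum_fun (\sum_(i <- s) dsum_in (dsum_fun f i)) j
    = \sum_(i <- s) dprod_in (dsum_fun f i) j.
  exact: (raddf_sum (lin_of (@dsum_fun_linear j))).
have [js|js] := boolP ((j : {classic I}) \in s).
  rewrite (bigD1_seq (j : {classic I})) //= dprod_inE big1 ?addr0 //.
  by move=> i /eqP ij; apply: dprod_in_neq.
rewrite big1_seq.
  by apply: contrapT => fj; move/negP: js; apply; apply: fs.
move=> i /= si; apply: dprod_in_neq => ij.
by move: js; rewrite -ij si.
Qed.

Lemma dsum_dec (f : dsum) : exists2 s : seq {classic I}, uniq s &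
  forall i : {classic I}, dsum_fun f i <> 0 -> i \in s.
Proof.
have /asboolP/(@finite_seqP {classic I}) [s fs] := valP f.
exists (undup s); first exact: undup_uniq.
move=> i fi; rewrite mem_undup.
by have : dsupp (val f) i by []; rewrite fs.
Qed.

Lemma dsum_ind (P : dsum -> Prop) : P 0 -> (forall f g, P f -> P g -> P (f + g)) ->
  (forall i v, P (@dsum_in i v)) -> forall f, P f.
Proof.
move=> P0 PD Pin f; have [s us fs] := dsum_dec f.
rewrite (dsum_decomp us fs); elim/big_rec: _ => // i g _ Pg.
exact: PD.
Qed.

Section Lift.
Variables (W : lmodType k) (phi : forall i, V i -> W).
Arguments phi : clear implicits.

(* The sum is over the support of [i |-> phi i (f i)], which is finite as soon
   as each [phi i] is linear. *)
Definition dsum_lift (f : dsum) : W :=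
  \sum_(i \in [set: {classic I}]) phi i (dsum_fun f i).

Hypothesis lphi : forall i, linear (phi i).

Lemma dsum_lift_seq f (s : seq {classic I}) : uniq s ->
  (forall i : {classic I}, dsum_fun f i <> 0 -> i \in s) ->
  dsum_lift f = \sum_(i <- s) phi i (dsum_fun f i).
Proof.
move=> us fs; rewrite /dsum_lift [RHS]fsbig_seq //.
apply/esym/fsbig_widen => [i _ //|i [_ is_]].
apply: contrapT => /eqP pi; apply: is_; apply: fs => fi.
by move: pi; rewrite fi (lin0 (@lphi i)) eqxx.
Qed.

Lemma dsum_lift_in i (v : V i) : dsum_lift (dsum_in v) = phi i v.
Proof.
rewrite (@dsum_lift_seq _ [:: (i : {classic I})]) //.
  by rewrite big_seq1 /dsum_fun /= dprod_inE.
move=> j /= ij; rewrite inE; apply/eqP.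
by apply: contrapT => ji; apply: ij; apply: dprod_in_neq => /esym.
Qed.

Lemma dsum_lift_linear : linear dsum_lift.
Proof.
move=> a f g; have [s us fs] := dsum_dec f; have [t ut gt] := dsum_dec g.
have Hf i : dsum_fun f i <> 0 -> (i : {classic I}) \in undup (s ++ t).
  by move=> fi; rewrite mem_undup mem_cat fs.
have Hg i : dsum_fun g i <> 0 -> (i : {classic I}) \in undup (s ++ t).
  by move=> gi; rewrite mem_undup mem_cat gt ?orbT.
rewrite !(@dsum_lift_seq _ (undup (s ++ t))) ?undup_uniq //.
  rewrite scaler_sumr -big_split; apply: eq_bigr => i _.
  by rewrite (dsum_fun_linear i a f g) lphi.
move=> i fgi; have [fi|] := pselect (dsum_fun f i = 0); last exact: Hf.
apply: Hg => gi; apply: fgi.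
by rewrite (dsum_fun_linear i a f g) fi gi scaler0 addr0.
Qed.

End Lift.
End DirectSum.

Section Tensor.
Variables (k : comPzRingType) (U V : lmodType k).

(* The free module with basis the set U * V. *)
Definition freemod : Type := dsum (fun _ : U * V => k^o : lmodType k).
HB.instance Definition _ := GRing.Lmodule.on freemod.

Definition freegen (u : U) (v : V) : freemod :=
  @dsum_in k (U * V)%type (fun _ => k^o) (u, v) (1 : k^o).

Inductive tensor_rel : freemod -> Prop :=
| tensor_rel_l a u u' v : tensor_rel
    (freegen (a *: u + u') v - (a *: freegen u v + freegen u' v))
| tensor_rel_r u a v v' : tensor_rel
    (freegen u (a *: v + v') - (a *: freegen u v + freegen u v')).

Definition tensor : Type := qmod (span tensor_rel).
HB.instance Definition _ := GRing.Lmodule.on tensor.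

Definition tens (u : U) (v : V) : tensor := qproj (span tensor_rel) (freegen u v).

Lemma tens_bilin : bilin tens.
Proof.
split=> [u a v v'|v a u u'] /=; apply: etrans (qproj_linear (span tensor_rel) a _ _).
- by apply/qprojP; apply: span_gen; apply: tensor_rel_r.
- by apply/qprojP; apply: span_gen; apply: tensor_rel_l.
Qed.

Lemma tensor_ind (P : tensor -> Prop) : P 0 ->
  (forall x y, P x -> P y -> P (x + y)) ->
  (forall u v, P (tens u v)) -> forall x, P x.
Proof.
move=> P0 PD Pt; elim/qmod_ind; elim/dsum_ind.
- by rewrite (lin0 (qproj_linear _)).
- by move=> f g Pf Pg; rewrite (linD (qproj_linear _)); apply: PD.
move=> [u v] a.
have -> : @dsum_in k _ (fun=> k^o) (u, v) a = a *: freegen u v.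
  rewrite /freegen -(linZ (@dsum_in_linear k _ (fun _ => k^o) (u, v))).
  by rewrite -[a *: _]/(a * 1 : k) mulr1.
rewrite (linZ (qproj_linear _)) -[qproj _ _]/(tens u v).
by rewrite -(linZ (tens_bilin.2 v)); apply: Pt.
Qed.

Section Lift.
Variables (W : lmodType k) (f : U -> V -> W).

Definition tensor_lift : tensor -> W :=
  qlift (dsum_lift (fun (p : U * V) (a : k^o) => (a : k) *: f p.1 p.2)).

Hypothesis bf : bilin f.

Let lphi (p : U * V) : linear (fun a : k^o => (a : k) *: f p.1 p.2).
Proof. by move=> a b c; rewrite scalerDl scalerA. Qed.

Let lphi_gen u v :
  dsum_lift (fun (p : U * V) (a : k^o) => (a : k) *: f p.1 p.2) (freegen u v) = f u v.
Proof. by rewrite dsum_lift_in //= scale1r. Qed.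

Let lphi0 x : x \in span tensor_rel ->
  dsum_lift (fun (p : U * V) (a : k^o) => (a : k) *: f p.1 p.2) x = 0.
Proof.
apply: span_ker; first exact: dsum_lift_linear.
by move=> _ [a u u' v|u a v v'];
  rewrite (linB (dsum_lift_linear lphi)) (dsum_lift_linear lphi) !lphi_gen
    ?(bilinP bf) ?(bilinPr bf) subrr.
Qed.

Lemma tensor_liftE u v : tensor_lift (tens u v) = f u v.
Proof.
by rewrite /tensor_lift /tens qliftE // ; exact: dsum_lift_linear.
Qed.

Lemma tensor_lift_linear : linear tensor_lift.
Proof. by apply: qlift_linear => //; exact: dsum_lift_linear. Qed.

End Lift.
End Tensor.

Section Monads.
Variable k : comPzRingType.

(* [T y x] is T(Y,X), whose elements go from X to Y; linear maps out of a tensor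
   product over [k] are given as bilinear maps. *)
Record monad (X : Type) := Monad {
  mhom :> X -> X -> lmodType k;
  mcomp : forall z y x, mhom z y -> mhom y x -> mhom z x;
  mone : forall x, mhom x x;
  mcomp_bilin : forall z y x, bilin (@mcomp z y x);
  mcompA : forall w z y x (h : mhom w z) (g : mhom z y) (f : mhom y x),
    mcomp h (mcomp g f) = mcomp (mcomp h g) f;
  mcomp1f : forall y x (f : mhom y x), mcomp (mone y) f = f;
  mcompf1 : forall y x (f : mhom y x), mcomp f (mone x) = f }.

Record lmodule (X : Type) (T : monad X) := LModule {
  lm_car :> X -> lmodType k;
  lm_act : forall y x, T y x -> lm_car x -> lm_car y;
  lm_bilin : forall y x, bilin (@lm_act y x);
  lm_actA : forall z y x (g : T z y) (f : T y x) (m : lm_car x),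
    lm_act g (lm_act f m) = lm_act (mcomp g f) m;
  lm_act1 : forall x (m : lm_car x), lm_act (mone T x) m = m }.

Record rmodule (X : Type) (T : monad X) := RModule {
  rm_car :> X -> lmodType k;
  rm_act : forall y x, rm_car y -> T y x -> rm_car x;
  rm_bilin : forall y x, bilin (@rm_act y x);
  rm_actA : forall z y x (n : rm_car z) (g : T z y) (f : T y x),
    rm_act (rm_act n g) f = rm_act n (mcomp g f);
  rm_act1 : forall x (n : rm_car x), rm_act n (mone T x) = n }.

Record bimodule (X Y : Type) (T : monad X) (S : monad Y) := Bimodule {
  bm_car :> X -> Y -> lmodType k;
  bm_lact : forall x' x y, T x' x -> bm_car x y -> bm_car x' y;
  bm_ract : forall x y y', bm_car x y -> S y y' -> bm_car x y';
  bm_lbilin : forall x' x y, bilin (@bm_lact x' x y);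
  bm_rbilin : forall x y y', bilin (@bm_ract x y y');
  bm_lactA : forall x2 x1 x y (g : T x2 x1) (f : T x1 x) (b : bm_car x y),
    bm_lact g (bm_lact f b) = bm_lact (mcomp g f) b;
  bm_lact1 : forall x y (b : bm_car x y), bm_lact (mone T x) b = b;
  bm_ractA : forall x y y1 y2 (b : bm_car x y) (g : S y y1) (f : S y1 y2),
    bm_ract (bm_ract b g) f = bm_ract b (mcomp g f);
  bm_ract1 : forall x y (b : bm_car x y), bm_ract b (mone S y) = b;
  bm_lract : forall x' x y y' (t : T x' x) (b : bm_car x y) (s : S y y'),
    bm_ract (bm_lact t b) s = bm_lact t (bm_ract b s) }.

Section LHom.
Variables (X : Type) (T : monad X).

Record lhom (M N : lmodule T) := LHom {
  lh_fun :> forall x, M x -> N x;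
  lh_linear : forall x, linear (@lh_fun x);
  lh_act : forall y x (t : T y x) (m : M x),
    lh_fun (lm_act t m) = lm_act t (lh_fun m) }.

Lemma lhom_ext (M N : lmodule T) (f g : lhom M N) :
  (forall x (m : M x), f x m = g x m) -> f = g.
Proof.
case: f g => [f lf af] [g lg ag] /= fg.
have {}fg : f = g.
  apply: functional_extensionality_dep => x.
  by apply: functional_extensionality_dep => m.
by subst g; congr LHom; apply: Prop_irrelevance.
Qed.

Definition lhom_id (M : lmodule T) : lhom M M.
Proof. by exists (fun x m => m). Defined.

Definition lhom_comp (M N P : lmodule T) (g : lhom N P) (f : lhom M N) : lhom M P.
Proof.
exists (fun x m => g x (f x m)).
- by move=> x a u v /=; rewrite !lh_linear.
- by move=> y x t m; rewrite !lh_act.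
Defined.

Section LHomModule.
Variables M N : lmodule T.

HB.instance Definition _ := gen_eqMixin (lhom M N).
HB.instance Definition _ := gen_choiceMixin (lhom M N).

Definition lhom_zero : lhom M N.
Proof.
exists (fun x m => 0) => [x a u v|y x t m] /=; first by rewrite scaler0 addr0.
by rewrite (bilin0r (@lm_bilin X T N y x)).
Defined.

Definition lhom_add (f g : lhom M N) : lhom M N.
Proof.
exists (fun x m => f x m + g x m) => [x b u v|y x t m] /=.
- by rewrite !lh_linear !scalerDr addrACA.
- by rewrite !lh_act -(linD ((@lm_bilin X T N y x).1 t)).
Defined.

Definition lhom_scale (a : k) (f : lhom M N) : lhom M N.
Proof.
exists (fun x m => a *: f x m) => [x b u v|y x t m] /=.
- by rewrite !lh_linear !scalerDr !scalerA [a * b]mulrC.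
- by rewrite !lh_act -(linZ ((@lm_bilin X T N y x).1 t)).
Defined.

Definition lhom_opp (f : lhom M N) : lhom M N := lhom_scale (-1) f.

Fact lhom_addA : associative lhom_add.
Proof. by move=> f g h; apply: lhom_ext => x m /=; rewrite addrA. Qed.
Fact lhom_addC : commutative lhom_add.
Proof. by move=> f g; apply: lhom_ext => x m /=; rewrite addrC. Qed.
Fact lhom_add0 : left_id lhom_zero lhom_add.
Proof. by move=> f; apply: lhom_ext => x m /=; rewrite add0r. Qed.
Fact lhom_addN : left_inverse lhom_zero lhom_opp lhom_add.
Proof. by move=> f; apply: lhom_ext => x m /=; rewrite scaleN1r addNr. Qed.
HB.instance Definition _ :=
  GRing.isZmodule.Build (lhom M N) lhom_addA lhom_addC lhom_add0 lhom_addN.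

Fact lhom_scaleA a b f : lhom_scale a (lhom_scale b f) = lhom_scale (a * b) f.
Proof. by apply: lhom_ext => x m /=; rewrite scalerA. Qed.
Fact lhom_scale1 : left_id 1 lhom_scale.
Proof. by move=> f; apply: lhom_ext => x m /=; rewrite scale1r. Qed.
Fact lhom_scaleDr : right_distributive lhom_scale +%R.
Proof. by move=> a f g; apply: lhom_ext => x m /=; rewrite scalerDr. Qed.
Fact lhom_scaleDl f : {morph lhom_scale^~ f : a b / a + b}.
Proof. by move=> a b; apply: lhom_ext => x m /=; rewrite scalerDl. Qed.
HB.instance Definition _ := GRing.Zmodule_isLmodule.Build k (lhom M N)
  lhom_scaleA lhom_scale1 lhom_scaleDr lhom_scaleDl.
End LHomModule.
End LHom.

Section RHom.
Variables (X : Type) (T : monad X).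

Record rhom (M N : rmodule T) := RHom {
  rh_fun :> forall x, M x -> N x;
  rh_linear : forall x, linear (@rh_fun x);
  rh_act : forall y x (m : M y) (t : T y x),
    rh_fun (rm_act m t) = rm_act (rh_fun m) t }.

Lemma rhom_ext (M N : rmodule T) (f g : rhom M N) :
  (forall x (m : M x), f x m = g x m) -> f = g.
Proof.
case: f g => [f lf af] [g lg ag] /= fg.
have {}fg : f = g.
  apply: functional_extensionality_dep => x.
  by apply: functional_extensionality_dep => m.
by subst g; congr RHom; apply: Prop_irrelevance.
Qed.

Definition rhom_id (M : rmodule T) : rhom M M.
Proof. by exists (fun x m => m). Defined.

Definition rhom_comp (M N P : rmodule T) (g : rhom N P) (f : rhom M N) : rhom M P.
Proof.
exists (fun x m => g x (f x m)).
- by move=> x a u v /=; rewrite !rh_linear.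
- by move=> y x m t; rewrite !rh_act.
Defined.

Section RHomModule.
Variables M N : rmodule T.

HB.instance Definition _ := gen_eqMixin (rhom M N).
HB.instance Definition _ := gen_choiceMixin (rhom M N).

Definition rhom_zero : rhom M N.
Proof.
exists (fun x m => 0) => [x a u v|y x m t] /=; first by rewrite scaler0 addr0.
by rewrite (bilin0l (@rm_bilin X T N y x)).
Defined.

Definition rhom_add (f g : rhom M N) : rhom M N.
Proof.
exists (fun x m => f x m + g x m) => [x b u v|y x m t] /=.
- by rewrite !rh_linear !scalerDr addrACA.
- by rewrite !rh_act -(linD ((@rm_bilin X T N y x).2 t)).
Defined.

Definition rhom_scale (a : k) (f : rhom M N) : rhom M N.
Proof.
exists (fun x m => a *: f x m) => [x b u v|y x m t] /=.
- by rewrite !rh_linear !scalerDr !scalerA [a * b]mulrC.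
- by rewrite !rh_act -(linZ ((@rm_bilin X T N y x).2 t)).
Defined.

Definition rhom_opp (f : rhom M N) : rhom M N := rhom_scale (-1) f.

Fact rhom_addA : associative rhom_add.
Proof. by move=> f g h; apply: rhom_ext => x m /=; rewrite addrA. Qed.
Fact rhom_addC : commutative rhom_add.
Proof. by move=> f g; apply: rhom_ext => x m /=; rewrite addrC. Qed.
Fact rhom_add0 : left_id rhom_zero rhom_add.
Proof. by move=> f; apply: rhom_ext => x m /=; rewrite add0r. Qed.
Fact rhom_addN : left_inverse rhom_zero rhom_opp rhom_add.
Proof. by move=> f; apply: rhom_ext => x m /=; rewrite scaleN1r addNr. Qed.
HB.instance Definition _ :=
  GRing.isZmodule.Build (rhom M N) rhom_addA rhom_addC rhom_add0 rhom_addN.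

Fact rhom_scaleA a b f : rhom_scale a (rhom_scale b f) = rhom_scale (a * b) f.
Proof. by apply: rhom_ext => x m /=; rewrite scalerA. Qed.
Fact rhom_scale1 : left_id 1 rhom_scale.
Proof. by move=> f; apply: rhom_ext => x m /=; rewrite scale1r. Qed.
Fact rhom_scaleDr : right_distributive rhom_scale +%R.
Proof. by move=> a f g; apply: rhom_ext => x m /=; rewrite scalerDr. Qed.
Fact rhom_scaleDl f : {morph rhom_scale^~ f : a b / a + b}.
Proof. by move=> a b; apply: rhom_ext => x m /=; rewrite scalerDl. Qed.
HB.instance Definition _ := GRing.Zmodule_isLmodule.Build k (rhom M N)
  rhom_scaleA rhom_scale1 rhom_scaleDr rhom_scaleDl.
End RHomModule.
End RHom.

Section BalancedTensor.
Variables (Y : Type) (S : monad Y).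

Section Def.
Variables (N : rmodule S) (M : lmodule S).

Definition tensor_sum : Type := dsum (fun y => tensor (N y) (M y) : lmodType k).
HB.instance Definition _ := GRing.Lmodule.on tensor_sum.

Definition bgen y (n : N y) (m : M y) : tensor_sum :=
  @dsum_in k Y (fun y => tensor (N y) (M y) : lmodType k) y (tens n m).

Inductive balance_rel : tensor_sum -> Prop :=
| BalanceRel y x (n : N y) (s : S y x) (m : M x) :
    balance_rel (bgen (rm_act n s) m - bgen n (lm_act s m)).

Definition btensor : Type := qmod (span balance_rel).
HB.instance Definition _ := GRing.Lmodule.on btensor.

Definition btens y (n : N y) (m : M y) : btensor :=
  qproj (span balance_rel) (bgen n m).

Lemma btens_bilin y : bilin (@btens y).
Proof.
split=> [u a v v'|v a u u'] /=; rewrite /btens -(qproj_linear (span balance_rel));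
 congr qproj; rewrite /bgen -dsum_in_linear; congr dsum_in.
- by rewrite (bilinPr (@tens_bilin k (N y) (M y))).
- by rewrite (bilinP (@tens_bilin k (N y) (M y))).
Qed.

Lemma btens_balanced y x (n : N y) (s : S y x) (m : M x) :
  btens (rm_act n s) m = btens n (lm_act s m).
Proof. by apply/qprojP; apply: span_gen. Qed.

Lemma btensor_ind (P : btensor -> Prop) : P 0 ->
  (forall x y, P x -> P y -> P (x + y)) ->
  (forall y n m, P (@btens y n m)) -> forall x, P x.
Proof.
move=> P0 PD Pt; elim/qmod_ind; elim/dsum_ind.
- by rewrite (lin0 (qproj_linear _)).
- by move=> f g Pf Pg; rewrite (linD (qproj_linear _)); apply: PD.
move=> y; elim/tensor_ind.
- rewrite (lin0 (@dsum_in_linear k Y _ y)).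
  by rewrite (lin0 (qproj_linear _)).
- move=> u v Pu Pv; rewrite (linD (@dsum_in_linear k Y _ y)).
  by rewrite (linD (qproj_linear _)); apply: PD.
- by move=> n m; apply: Pt.
Qed.

Lemma btensor_ext (W : lmodType k) (f g : btensor -> W) :
  linear f -> linear g ->
  (forall y (n : N y) (m : M y), f (btens n m) = g (btens n m)) ->
  forall x, f x = g x.
Proof.
move=> lf lg fg; elim/btensor_ind; first by rewrite (lin0 lf) (lin0 lg).
- by move=> x y; rewrite (linD lf) (linD lg) => -> ->.
- exact: fg.
Qed.

Section Lift.
Variables (W : lmodType k) (f : forall y, N y -> M y -> W).

Definition btensor_lift : btensor -> W :=
  qlift (dsum_lift (fun y => tensor_lift (@f y))).

Hypothesis bf : forall y, bilin (@f y).
Hypothesis balf : forall y x (n : N y) (s : S y x) (m : M x),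
  f (rm_act n s) m = f n (lm_act s m).

Let lphi y : linear (tensor_lift (@f y)).
Proof. exact: tensor_lift_linear. Qed.

Let lift_gen y (n : N y) (m : M y) :
  dsum_lift (fun y => tensor_lift (@f y)) (bgen n m) = f n m.
Proof. by rewrite /bgen dsum_lift_in // tensor_liftE. Qed.

Let lift0 x : x \in span balance_rel ->
  dsum_lift (fun y => tensor_lift (@f y)) x = 0.
Proof.
apply: span_ker; first exact: dsum_lift_linear.
move=> _ [y x' n s m].
by rewrite (linB (dsum_lift_linear lphi)) !lift_gen balf subrr.
Qed.

Lemma btensor_liftE y (n : N y) (m : M y) : btensor_lift (btens n m) = f n m.
Proof.
by rewrite /btensor_lift /btens qliftE //; exact: dsum_lift_linear.
Qed.

Lemma btensor_lift_linear : linear btensor_lift.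
Proof. by apply: qlift_linear => //; exact: dsum_lift_linear. Qed.

End Lift.
End Def.

Section Map.
Variables (N N' : rmodule S) (M M' : lmodule S).

Definition btensor_map (f : rhom N N') (g : lhom M M') :
    btensor N M -> btensor N' M' :=
  btensor_lift (fun y n m => btens (f y n) (g y m)).

Section Properties.
Variables (f : rhom N N') (g : lhom M M').

Let bfg y : bilin (fun (n : N y) (m : M y) => btens (f y n) (g y m)).
Proof.
split=> [n a m m'|m a n n'] /=.
- by rewrite lh_linear (bilinPr (@btens_bilin N' M' y)).
- by rewrite rh_linear (bilinP (@btens_bilin N' M' y)).
Qed.

Let balfg y x (n : N y) (s : S y x) (m : M x) :
  btens (f x (rm_act n s)) (g x m) = btens (f y n) (g y (lm_act s m)).
Proof. by rewrite rh_act lh_act btens_balanced. Qed.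

Lemma btensor_mapE y (n : N y) (m : M y) :
  btensor_map f g (btens n m) = btens (f y n) (g y m).
Proof. exact: (btensor_liftE bfg balfg). Qed.

Lemma btensor_map_linear : linear (btensor_map f g).
Proof. exact: (btensor_lift_linear bfg balfg). Qed.
End Properties.
End Map.

Lemma btensor_map_id (N : rmodule S) (M : lmodule S)
  (f : rhom N N) (g : lhom M M) x :
  (forall y n, f y n = n) -> (forall y m, g y m = m) ->
  @btensor_map N N M M f g x = x.
Proof.
move=> fE gE; move: x.
apply: btensor_ext => //; first exact: btensor_map_linear.
by move=> y n m; rewrite btensor_mapE fE gE.
Qed.

Lemma btensor_map_comp (N N' N'' : rmodule S) (M M' M'' : lmodule S)
  (f' : rhom N' N'') (f : rhom N N') (f'' : rhom N N'')
  (g' : lhom M' M'') (g : lhom M M') (g'' : lhom M M'') x :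
  (forall y n, f' y (f y n) = f'' y n) -> (forall y m, g' y (g y m) = g'' y m) ->
  btensor_map f' g' (btensor_map f g x) = btensor_map f'' g'' x.
Proof.
move=> fE gE; move: x.
apply: btensor_ext => [a u v| |y n m].
- apply: etrans (btensor_map_linear f' g' a _ _).
  by congr btensor_map; apply: btensor_map_linear.
- exact: btensor_map_linear.
- by rewrite !btensor_mapE fE gE.
Qed.

End BalancedTensor.

Section BimoduleConstructions.
Variables (X Y : Type) (T : monad X) (S : monad Y) (B : bimodule T S).

(* The left module B(-,y) and the right module B(x,-). *)
Definition bm_left (y : Y) : lmodule T :=
  @LModule X T (fun x => B x y) (fun x' x => @bm_lact X Y T S B x' x y)
    (fun x' x => @bm_lbilin X Y T S B x' x y)
    (fun x2 x1 x => @bm_lactA X Y T S B x2 x1 x y)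
    (fun x => @bm_lact1 X Y T S B x y).

Definition bm_right (x : X) : rmodule S :=
  @RModule Y S (fun y => B x y) (fun y y' => @bm_ract X Y T S B x y y')
    (fun y y' => @bm_rbilin X Y T S B x y y')
    (fun y y1 y2 => @bm_ractA X Y T S B x y y1 y2)
    (fun y => @bm_ract1 X Y T S B x y).

Definition bm_lact_rhom x' x (t : T x' x) : rhom (bm_right x) (bm_right x').
Proof.
exists (fun y (b : B x y) => bm_lact t b) => [y a u v|y' y b s] /=.
- by rewrite (bilinPr (@bm_lbilin X Y T S B x' x y)).
- by rewrite bm_lract.
Defined.

Definition bm_ract_lhom y y' (s : S y y') : lhom (bm_left y) (bm_left y').
Proof.
exists (fun x (b : B x y) => bm_ract b s) => [x a u v|x' x t b] /=.
- by rewrite (bilinP (@bm_rbilin X Y T S B x y y')).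
- by rewrite bm_lract.
Defined.

Definition tensorL (N : lmodule S) : lmodule T.
Proof.
exists (fun x => btensor (bm_right x) N : lmodType k)
  (fun x' x t => btensor_map (bm_lact_rhom t) (lhom_id N)).
- move=> x' x; split=> [t|u a t t' /=]; first exact: btensor_map_linear.
  elim/btensor_ind: u => [|u v Hu Hv|y n m].
  + by rewrite !(lin0 (btensor_map_linear _ _)) scaler0 addr0.
  + by rewrite !(linD (btensor_map_linear _ _)) Hu Hv scalerDr addrACA.
  + rewrite !btensor_mapE /= (bilinP (@bm_lbilin X Y T S B x' x y)).
    by rewrite (bilinP (@btens_bilin Y S (bm_right x') N y)).
- move=> z y x g f m; apply: btensor_map_comp => //= y' n.
  exact: bm_lactA.
- by move=> x m; apply: btensor_map_id => //= y n; apply: bm_lact1.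
Defined.

Definition tensorR (N : rmodule T) : rmodule S.
Proof.
exists (fun y => btensor N (bm_left y) : lmodType k)
  (fun y y' u s => btensor_map (rhom_id N) (bm_ract_lhom s) u).
- move=> y y'; split=> [u a s s' /=|s]; last exact: btensor_map_linear.
  elim/btensor_ind: u => [|u v Hu Hv|x n m].
  + by rewrite !(lin0 (btensor_map_linear _ _)) scaler0 addr0.
  + by rewrite !(linD (btensor_map_linear _ _)) Hu Hv scalerDr addrACA.
  + rewrite !btensor_mapE /= (bilinPr (@bm_rbilin X Y T S B x y y')).
    by rewrite (bilinPr (@btens_bilin X T N (bm_left y') x)).
- move=> z y x m g f; apply: btensor_map_comp => //= y' n.
  exact: bm_ractA.
- by move=> y m; apply: btensor_map_id => //= x n; apply: bm_ract1.
Defined.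

Definition homL (M : lmodule T) : lmodule S.
Proof.
exists (fun y => lhom (bm_left y) M : lmodType k)
  (fun y y' s (phi : lhom (bm_left y') M) => lhom_comp phi (bm_ract_lhom s)).
- move=> y y'; split=> [s a f g|f a s s']; apply: lhom_ext => x b //=.
  rewrite (bilinPr (@bm_rbilin X Y T S B x y y')) lh_linear //.
- move=> z y x g f phi; apply: lhom_ext => w b /=.
  by congr (phi _ _); apply: bm_ractA.
- move=> y phi; apply: lhom_ext => w b /=.
  by congr (phi _ _); apply: bm_ract1.
Defined.

Definition homR (N : rmodule S) : rmodule T.
Proof.
exists (fun x => rhom (bm_right x) N : lmodType k)
  (fun x' x (phi : rhom (bm_right x') N) t => rhom_comp phi (bm_lact_rhom t)).
- move=> x' x; split=> [f a s s'|s a f g]; apply: rhom_ext => y b //=.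
  rewrite (bilinP (@bm_lbilin X Y T S B x' x y)) rh_linear //.
- move=> z y x phi g f; apply: rhom_ext => w b /=.
  by congr (phi _ _); apply: bm_lactA.
- move=> x phi; apply: rhom_ext => w b /=.
  by congr (phi _ _); apply: bm_lact1.
Defined.

End BimoduleConstructions.
End Monads.

Record category := Category {
  ob :> Type;
  hom : ob -> ob -> Type;
  idm : forall a, hom a a;
  compm : forall a b c, hom b c -> hom a b -> hom a c;
  compmA : forall a b c d (h : hom c d) (g : hom b c) (f : hom a b),
    compm h (compm g f) = compm (compm h g) f;
  comp1m : forall a b (f : hom a b), compm (idm b) f = f;
  compm1 : forall a b (f : hom a b), compm f (idm a) = f }.

Record functor (C D : category) := Functor {
  fob :> C -> D;
  fmap : forall a b, hom a b -> hom (fob a) (fob b);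
  fmap_id : forall a, fmap (idm a) = idm (fob a);
  fmap_comp : forall a b c (g : hom b c) (f : hom a b),
    fmap (compm g f) = compm (fmap g) (fmap f) }.

(* F is left adjoint to G: bijections D(F c, d) ~ C(c, G d), natural in c, d. *)
Record adjunction (C D : category) (F : functor C D) (G : functor D C) := Adjunction {
  adj : forall (c : C) (d : D), hom (F c) d -> hom c (G d);
  adj_bij : forall c d, bijective (@adj c d);
  adj_natl : forall (c c' : C) (d : D) (f : hom c' c) (u : hom (F c) d),
    adj (compm u (fmap F f)) = compm (adj u) f;
  adj_natr : forall (c : C) (d d' : D) (g : hom d d') (u : hom (F c) d),
    adj (compm g u) = compm (fmap G g) (adj u) }.

Section ModuleCategories.
Variable k : comPzRingType.

Definition LMod (X : Type) (T : monad k X) : category.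
Proof.
by exists (lmodule T) (@lhom k X T) (@lhom_id k X T) (@lhom_comp k X T);
  move=> *; apply: lhom_ext.
Defined.

Definition RMod (X : Type) (T : monad k X) : category.
Proof.
by exists (rmodule T) (@rhom k X T) (@rhom_id k X T) (@rhom_comp k X T);
  move=> *; apply: rhom_ext.
Defined.

Section Functors.
Variables (X Y : Type) (T : monad k X) (S : monad k Y) (B : bimodule T S).

Definition tensorL_map (N N' : lmodule S) (f : lhom N N') :
  lhom (tensorL B N) (tensorL B N').
Proof.
exists (fun x => btensor_map (rhom_id (bm_right B x)) f).
- by move=> x; apply: btensor_map_linear.
- move=> x' x t m /=.
  rewrite (btensor_map_comp (f'' := bm_lact_rhom B t) (g'' := f)) //.
  by rewrite (btensor_map_comp (f'' := bm_lact_rhom B t) (g'' := f)).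
Defined.

Definition tensorR_map (N N' : rmodule T) (f : rhom N N') :
  rhom (tensorR B N) (tensorR B N').
Proof.
exists (fun y => btensor_map f (lhom_id (bm_left B y))).
- by move=> y; apply: btensor_map_linear.
- move=> y y' m s /=.
  rewrite (btensor_map_comp (f'' := f) (g'' := bm_ract_lhom B s)) //.
  by rewrite (btensor_map_comp (f'' := f) (g'' := bm_ract_lhom B s)).
Defined.

Definition homL_map (M M' : lmodule T) (f : lhom M M') :
  lhom (homL B M) (homL B M').
Proof.
exists (fun y (phi : lhom (bm_left B y) M) => lhom_comp f phi).
- by move=> y a u v; apply: lhom_ext => x b /=; rewrite lh_linear.
- by move=> y y' s phi; apply: lhom_ext.
Defined.

Definition homR_map (N N' : rmodule S) (f : rhom N N') :
  rhom (homR B N) (homR B N').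
Proof.
exists (fun x (phi : rhom (bm_right B x) N) => rhom_comp f phi).
- by move=> y a u v; apply: rhom_ext => x b /=; rewrite rh_linear.
- by move=> x' x phi t; apply: rhom_ext.
Defined.

Definition tensorL_functor : functor (LMod S) (LMod T).
Proof.
exists (tensorL B : LMod S -> LMod T) tensorL_map => [N|N N' N'' g f];
  apply: lhom_ext => x u /=; first exact: btensor_map_id.
by apply/esym/btensor_map_comp.
Defined.

Definition homL_functor : functor (LMod T) (LMod S).
Proof.
by exists (homL B : LMod T -> LMod S) homL_map => [N|N N' N'' g f];
  apply: lhom_ext => x u /=; apply: lhom_ext.
Defined.

Definition tensorR_functor : functor (RMod T) (RMod S).
Proof.
exists (tensorR B : RMod T -> RMod S) tensorR_map => [N|N N' N'' g f];
  apply: rhom_ext => x u /=; first exact: btensor_map_id.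
by apply/esym/btensor_map_comp.
Defined.

Definition homR_functor : functor (RMod S) (RMod T).
Proof.
by exists (homR B : RMod S -> RMod T) homR_map => [N|N N' N'' g f];
  apply: rhom_ext => x u /=; apply: rhom_ext.
Defined.

End Functors.
End ModuleCategories.

Section Ideals.
Variables (k : comPzRingType) (X : Type).

Record submonad (T : monad k X) := Submonad {
  sm_car :> forall y x, submodClosed (T y x);
  sm_comp : forall z y x (g : T z y) (f : T y x),
    g \in sm_car z y -> f \in sm_car y x -> mcomp g f \in sm_car z x;
  sm_one : forall x, mone T x \in sm_car x x }.

Definition submonad_monad (T : monad k X) (S : submonad T) : monad k X.
Proof.
exists (fun y x => submod (S y x) : lmodType k)
  (fun z y x (g : submod (S z y)) (f : submod (S y x)) =>
     in_submod (sm_comp (valP g) (valP f)))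
  (fun x => in_submod (sm_one S x)).
- move=> z y x; split=> [g a f f'|f a g g']; apply: val_inj => /=.
  + by rewrite (bilinPr (@mcomp_bilin k X T z y x)).
  + by rewrite (bilinP (@mcomp_bilin k X T z y x)).
- by move=> *; apply: val_inj; apply: mcompA.
- by move=> *; apply: val_inj; apply: mcomp1f.
- by move=> *; apply: val_inj; apply: mcompf1.
Defined.

Record left_ideal (T : monad k X) := LeftIdeal {
  li_car :> forall y x, submodClosed (T y x);
  li_comp : forall z y x (g : T z y) (f : T y x),
    f \in li_car y x -> mcomp g f \in li_car z x }.

Record ideal (T : monad k X) := Ideal {
  id_car :> forall y x, submodClosed (T y x);
  id_compl : forall z y x (g : T z y) (f : T y x),
    f \in id_car y x -> mcomp g f \in id_car z x;
  id_compr : forall z y x (g : T z y) (f : T y x),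
    g \in id_car z y -> mcomp g f \in id_car z x }.

Section QuotientMonad.
Variables (T : monad k X) (I : ideal T).

Definition qmcomp z y x (g : qmod (I z y)) (f : qmod (I y x)) : qmod (I z x) :=
  qproj (I z x) (mcomp (qrepr g) (qrepr f)).

Lemma qmcompE z y x (g : T z y) (f : T y x) :
  qmcomp (qproj (I z y) g) (qproj (I y x) f) = qproj (I z x) (mcomp g f).
Proof.
have bT := @mcomp_bilin k X T z y x.
set g' := qrepr (qproj (I z y) g); set f' := qrepr (qproj (I y x) f).
have Hg : g' - g \in I z y by apply/qprojP; rewrite qreprK.
have Hf : f' - f \in I y x by apply/qprojP; rewrite qreprK.
apply/qprojP; rewrite -(subrKA (mcomp g' f)).
rewrite -(bilinBr bT) -(bilinBl bT).
by apply: rpredD; [apply: id_compl | apply: id_compr].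
Qed.

Definition quotient_monad : monad k X.
Proof.
exists (fun y x => qmod (I y x) : lmodType k) qmcomp
  (fun x => qproj (I x x) (mone T x)).
- move=> z y x; split=> [g a|f a].
  + elim/qmod_ind: g => g; elim/qmod_ind=> f; elim/qmod_ind=> f'.
    rewrite -qproj_linear !qmcompE -qproj_linear.
    by rewrite (bilinPr (@mcomp_bilin k X T z y x)).
  + elim/qmod_ind: f => f; elim/qmod_ind=> g; elim/qmod_ind=> g'.
    rewrite -qproj_linear !qmcompE -qproj_linear.
    by rewrite (bilinP (@mcomp_bilin k X T z y x)).
- move=> w z y x; elim/qmod_ind=> h; elim/qmod_ind=> g; elim/qmod_ind=> f.
  by rewrite !qmcompE mcompA.
- by move=> y x; elim/qmod_ind=> f; rewrite qmcompE mcomp1f.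
- by move=> y x; elim/qmod_ind=> f; rewrite qmcompE mcompf1.
Defined.
End QuotientMonad.

Section Eigenmonad.
Variables (T : monad k X) (J : left_ideal T).

Definition idealizer_pred y x : {pred T y x} := fun f =>
  `[< forall z (j : T z y), j \in J z y -> mcomp j f \in J z x >].

Fact idealizer_closed y x : subsemimod_closed (@idealizer_pred y x).
Proof.
split; first split.
- apply/asboolP => z j Jj; rewrite (bilin0r (@mcomp_bilin k X T z y x)).
  exact: rpred0.
- move=> f g /asboolP Hf /asboolP Hg; apply/asboolP => z j Jj.
  rewrite (linD ((@mcomp_bilin k X T z y x).1 j)).
  by apply: rpredD; [apply: Hf | apply: Hg].
- move=> a f /asboolP Hf; apply/asboolP => z j Jj.
  rewrite (linZ ((@mcomp_bilin k X T z y x).1 j)).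
  by apply/rpredZ/Hf.
Qed.
HB.instance Definition _ y x :=
  GRing.isSubSemiModClosed.Build k (T y x) (@idealizer_pred y x)
    (@idealizer_closed y x).

Definition idealizer : submonad T.
Proof.
exists (fun y x => @idealizer_pred y x : submodClosed (T y x)).
- move=> z y x g f /asboolP Hg /asboolP Hf; apply/asboolP => w j Jj.
  by rewrite mcompA; apply/Hf/Hg.
- by move=> x; apply/asboolP => z j Jj; rewrite mcompf1.
Defined.

Lemma li_idealizer y x (f : T y x) : f \in J y x -> f \in idealizer y x.
Proof. by move=> Jf; apply/asboolP => z j _; apply: li_comp. Qed.

(* J, viewed inside its idealizer. *)
Definition li_restr_pred y x : {pred submonad_monad idealizer y x} :=
  fun f => val f \in J y x.

Fact li_restr_closed y x : subsemimod_closed (@li_restr_pred y x).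
Proof.
split; first split.
- exact: (rpred0 (J y x)).
- by move=> f g; apply: (rpredD (S := J y x)).
- by move=> a f; apply: (rpredZ (s := J y x)).
Qed.
HB.instance Definition _ y x :=
  GRing.isSubSemiModClosed.Build k (submonad_monad idealizer y x)
    (@li_restr_pred y x) (@li_restr_closed y x).

Definition li_restr : ideal (submonad_monad idealizer).
Proof.
exists (fun y x => @li_restr_pred y x : submodClosed (submonad_monad idealizer y x)).
- by move=> z y x g f Jf; apply: li_comp.
- by move=> z y x g f Jg; have /asboolP := valP f; apply.
Defined.

Definition eigenmonad : monad k X := quotient_monad li_restr.

Definition qbim_lact x' x y (t : T x' x) : qmod (J x y) -> qmod (J x' y) :=
  qlift (fun f => qproj (J x' y) (mcomp t f)).

Lemma qbim_lact_bilin0 x' x y (t : T x' x) :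
  linear (fun f => qproj (J x' y) (mcomp t f)).
Proof.
by move=> a f g; rewrite (bilinPr (@mcomp_bilin k X T x' x y)) qproj_linear.
Qed.

Lemma qbim_lactE x' x y (t : T x' x) (f : T x y) :
  qbim_lact t (qproj (J x y) f) = qproj (J x' y) (mcomp t f).
Proof.
apply: qliftE => [|v Jv]; first exact: qbim_lact_bilin0.
by apply/qproj0/li_comp.
Qed.

Definition qbim_ract x y y' (b : qmod (J x y)) (e : eigenmonad y y') :
    qmod (J x y') :=
  qproj (J x y') (mcomp (qrepr b) (val (qrepr (e : qmod (li_restr y y'))))).

Lemma qbim_ractE x y y' (f : T x y) (e : submonad_monad idealizer y y') :
  qbim_ract (qproj (J x y) f) (qproj (li_restr y y') e)
  = qproj (J x y') (mcomp f (val e)).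
Proof.
have bT := @mcomp_bilin k X T x y y'; rewrite /qbim_ract.
set f' := qrepr (qproj (J x y) f); set e' := qrepr (qproj (li_restr y y') e).
have Hf : f' - f \in J x y by apply/qprojP; rewrite qreprK.
have He : e' - e \in li_restr y y' by apply/qprojP; rewrite qreprK.
apply/qprojP; rewrite -(subrKA (mcomp f (val e'))).
rewrite -(bilinBr bT) -(bilinBl bT) rpredD //; last by apply: li_comp; exact: He.
by have /asboolP := valP e'; apply.
Qed.

Definition quotient_bimodule : bimodule T eigenmonad.
Proof.
exists (fun x y => qmod (J x y) : lmodType k) qbim_lact qbim_ract.
- move=> x' x y; split=> [t|q a t t' /=].
    apply: qlift_linear => [|v Jv]; first exact: qbim_lact_bilin0.
    by apply/qproj0/li_comp.
  elim/qmod_ind: q => f; rewrite !qbim_lactE -qproj_linear.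
  by rewrite (bilinP (@mcomp_bilin k X T x' x y)).
- move=> x y y'; split=> [q a|e a].
  + elim/qmod_ind: q => f; elim/qmod_ind=> e; elim/qmod_ind=> e'.
    rewrite -qproj_linear !qbim_ractE -qproj_linear /=.
    by rewrite (bilinPr (@mcomp_bilin k X T x y y')).
  + elim/qmod_ind: e => e; elim/qmod_ind=> f; elim/qmod_ind=> f'.
    rewrite -qproj_linear !qbim_ractE -qproj_linear.
    by rewrite (bilinP (@mcomp_bilin k X T x y y')).
- move=> x2 x1 x y g f; elim/qmod_ind=> b.
  by rewrite !qbim_lactE mcompA.
- by move=> x y; elim/qmod_ind=> b; rewrite qbim_lactE mcomp1f.
- move=> x y y1 y2; elim/qmod_ind=> b; elim/qmod_ind=> g; elim/qmod_ind=> f.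
  by rewrite [mcomp _ _]qmcompE !qbim_ractE /= mcompA.
- by move=> x y; elim/qmod_ind=> b; rewrite qbim_ractE mcompf1.
- move=> x' x y y' t; elim/qmod_ind=> b; elim/qmod_ind=> s.
  by rewrite qbim_lactE !qbim_ractE qbim_lactE mcompA.
Defined.

End Eigenmonad.
End Ideals.

(* Main.v *)
Require Import Defs.
From mathcomp Require Import all_boot all_algebra.

(* Both adjunctions are instances of tensor-hom adjunctions valid for every
   bimodule [B]: currying sends [u] to [n |-> (b |-> u (b (x) n))]; conversely
   [(b, n) |-> v n b] is bilinear and balanced, so it factors through the
   balanced tensor product. *)

Section LeftAdjunction.
Context {k : comPzRingType} {X Y : Type} {T : monad k X} {S : monad k Y}.
Variable B : bimodule T S.

(** [B(x, y)] is viewed in [bm_left B y] as the source of a [T]-linear map and in [bm_right B x] as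
    a tensor factor; the two are convertible. *)
Definition curryL {N : lmodule S} {M : lmodule T} (u : lhom (tensorL B N) M) :
  lhom N (homL B M).
Proof.
unshelve eexists.
- move=> y n; exists (fun x (b : bm_left B y x) =>
    u x (@btens _ _ _ (bm_right B x) N y b n)).
  + by move=> x a b b'; rewrite (bilinP (btens_bilin _ _ y)) lh_linear.
  (* [T] acts on the tensor product through the factor from [B] alone. *)
  + by move=> x' x t b; rewrite -lh_act /= btensor_mapE.
- move=> y a n n'; apply: lhom_ext => x b /=.
  by rewrite (bilinPr (btens_bilin _ _ y)) lh_linear.
- move=> y' y s n; apply: lhom_ext => x b /=.
  (* [s] acts on [homL B M] by precomposition with [b |-> b s], so [S]-linearity is the balancing
     relation under [u]. *)
  by rewrite -(@btens_balanced _ _ _ (bm_right B x) N).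
Defined.

Definition evalL {N : lmodule S} {M : lmodule T} (v : lhom N (homL B M)) x y
  (b : bm_right B x y) (n : N y) : M x := (v y n : lhom _ _) x b.

(** Linearity in [b] is that of each [v y n]; linearity in [n] is that of [v], as the operations of
    [homL B M] are pointwise. *)
Lemma evalL_bilin (N : lmodule S) (M : lmodule T) (v : lhom N (homL B M)) x y :
  bilin (evalL v x y).
Proof.
split=> [b a n n'|n a b b']; rewrite /evalL; last exact: lh_linear.
by rewrite lh_linear.
Qed.

Lemma evalL_balanced (N : lmodule S) (M : lmodule T) (v : lhom N (homL B M)) x
    y y' (b : bm_right B x y) (s : S y y') (n : N y') :
  evalL v x y' (rm_act b s) n = evalL v x y b (lm_act s n).
Proof. by rewrite /evalL lh_act. Qed.

Definition uncurryL_fun {N : lmodule S} {M : lmodule T}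
  (v : lhom N (homL B M)) x : tensorL B N x -> M x := btensor_lift (evalL v x).

Lemma uncurryL_funE (N : lmodule S) (M : lmodule T) (v : lhom N (homL B M))
    x y (b : bm_right B x y) (n : N y) :
  uncurryL_fun v x (btens b n) = evalL v x y b n.
Proof.
exact: (btensor_liftE (evalL_bilin N M v x) (evalL_balanced N M v x)).
Qed.

Lemma uncurryL_fun_linear (N : lmodule S) (M : lmodule T)
    (v : lhom N (homL B M)) x :
  linear (uncurryL_fun v x).
Proof.
exact: (btensor_lift_linear (evalL_bilin N M v x) (evalL_balanced N M v x)).
Qed.

Definition uncurryL {N : lmodule S} {M : lmodule T} (v : lhom N (homL B M)) :
  lhom (tensorL B N) M.
Proof.
exists (uncurryL_fun v); first exact: uncurryL_fun_linear.
(* Both sides are linear in the tensor, so it suffices to compare them on [btens b n], where the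
   claim is [T]-linearity of [v y n]. *)
move=> x' x t; apply: btensor_ext.
- move=> a p q; rewrite (bilinPr (lm_bilin _ _ _)).
  exact: uncurryL_fun_linear.
- move=> a p q; rewrite uncurryL_fun_linear.
  by rewrite (bilinPr (lm_bilin _ _ _)).
- move=> y b n; rewrite /= btensor_mapE !uncurryL_funE.
  exact: (lh_act (v y n : lhom _ _)).
Defined.

Lemma curryLK (N : lmodule S) (M : lmodule T) :
  cancel (@curryL N M) (@uncurryL N M).
Proof.
move=> u; apply: lhom_ext => x; apply: btensor_ext.
- exact: (lh_linear (uncurryL (curryL u))).
- exact: (lh_linear u).
- by move=> y b n; rewrite /= uncurryL_funE.
Qed.

(** Currying only evaluates at generators [btens b n], where the lift returns [v] by
    construction. *)
Lemma uncurryLK (N : lmodule S) (M : lmodule T) :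
  cancel (@uncurryL N M) (@curryL N M).
Proof.
move=> v; apply: lhom_ext => y n; apply: lhom_ext => x b.
exact: (uncurryL_funE _ _ v).
Qed.

Definition tensorL_homL_adjunction :
  adjunction (tensorL_functor B) (homL_functor B).
Proof.
exists (fun N M => @curryL N M).
- by move=> N M; exists uncurryL; [apply: curryLK | apply: uncurryLK].
(* Naturality in [N]: the tensor functor sends [btens b n] to [btens b (f y n)]. *)
- move=> N N' M f u; apply: lhom_ext => y n; apply: lhom_ext => x b /=.
  by rewrite btensor_mapE.
(* Naturality in [M]: both sides compute to postcomposition with [g]. *)
- by move=> N M M' g u; apply: lhom_ext => y n; apply: lhom_ext.
Defined.

End LeftAdjunction.

Section RightAdjunction.
Context {k : comPzRingType} {X Y : Type} {T : monad k X} {S : monad k Y}.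
Variable B : bimodule T S.

Definition curryR {N : rmodule T} {M : rmodule S} (u : rhom (tensorR B N) M) :
  rhom N (homR B M).
Proof.
unshelve eexists.
- move=> x n; exists (fun y (b : bm_right B x y) =>
    u y (@btens _ _ _ N (bm_left B y) x n b)).
  + by move=> y a b b'; rewrite (bilinPr (btens_bilin _ _ x)) rh_linear.
  + by move=> y y' b s; rewrite -rh_act /= btensor_mapE.
- move=> x a n n'; apply: rhom_ext => y b /=.
  by rewrite (bilinP (btens_bilin _ _ x)) rh_linear.
- move=> x' x n t; apply: rhom_ext => y b /=.
  (* Here balancing over [T] gives [T]-linearity, while [S] acts through the factor from [B]. *)
  by rewrite (@btens_balanced _ _ _ N (bm_left B y)).
Defined.

Definition evalR {N : rmodule T} {M : rmodule S} (v : rhom N (homR B M)) y x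
  (n : N x) (b : bm_left B y x) : M y := (v x n : rhom _ _) y b.

Lemma evalR_bilin (N : rmodule T) (M : rmodule S) (v : rhom N (homR B M)) y x :
  bilin (evalR v y x).
Proof.
split=> [n a b b'|b a n n']; rewrite /evalR; first exact: rh_linear.
by rewrite rh_linear.
Qed.

(** This is [T]-linearity of [v]: [t] acts on [homR B M] by precomposition with [b |-> t b]. *)
Lemma evalR_balanced (N : rmodule T) (M : rmodule S) (v : rhom N (homR B M)) y
    x' x (n : N x') (t : T x' x) (b : bm_left B y x) :
  evalR v y x (rm_act n t) b = evalR v y x' n (lm_act t b).
Proof. by rewrite /evalR rh_act. Qed.

Definition uncurryR_fun {N : rmodule T} {M : rmodule S}
  (v : rhom N (homR B M)) y : tensorR B N y -> M y := btensor_lift (evalR v y).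

Lemma uncurryR_funE (N : rmodule T) (M : rmodule S) (v : rhom N (homR B M))
    y x (n : N x) (b : bm_left B y x) :
  uncurryR_fun v y (btens n b) = evalR v y x n b.
Proof.
exact: (btensor_liftE (evalR_bilin N M v y) (evalR_balanced N M v y)).
Qed.

Lemma uncurryR_fun_linear (N : rmodule T) (M : rmodule S)
    (v : rhom N (homR B M)) y :
  linear (uncurryR_fun v y).
Proof.
exact: (btensor_lift_linear (evalR_bilin N M v y) (evalR_balanced N M v y)).
Qed.

Definition uncurryR {N : rmodule T} {M : rmodule S} (v : rhom N (homR B M)) :
  rhom (tensorR B N) M.
Proof.
exists (uncurryR_fun v); first exact: uncurryR_fun_linear.
(* With [s] fixed, both sides become linear functions of the tensor [p]. *)
move=> y y' p s; move: p; apply: btensor_ext.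
- move=> a p q; rewrite (bilinP (rm_bilin _ _ _)).
  exact: uncurryR_fun_linear.
- move=> a p q; rewrite uncurryR_fun_linear.
  by rewrite (bilinP (rm_bilin _ _ _)).
- move=> x n b; rewrite /= btensor_mapE !uncurryR_funE.
  exact: (rh_act (v x n : rhom _ _)).
Defined.

Lemma curryRK (N : rmodule T) (M : rmodule S) :
  cancel (@curryR N M) (@uncurryR N M).
Proof.
move=> u; apply: rhom_ext => y; apply: btensor_ext.
- exact: (rh_linear (uncurryR (curryR u))).
- exact: (rh_linear u).
- by move=> x n b; rewrite /= uncurryR_funE.
Qed.

Lemma uncurryRK (N : rmodule T) (M : rmodule S) :
  cancel (@uncurryR N M) (@curryR N M).
Proof.
move=> v; apply: rhom_ext => x n; apply: rhom_ext => y b.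
exact: (uncurryR_funE _ _ v).
Qed.

Definition tensorR_homR_adjunction :
  adjunction (tensorR_functor B) (homR_functor B).
Proof.
exists (fun N M => @curryR N M).
- by move=> N M; exists uncurryR; [apply: curryRK | apply: uncurryRK].
- move=> N N' M f u; apply: rhom_ext => x n; apply: rhom_ext => y b /=.
  by rewrite btensor_mapE.
- by move=> N M M' g u; apply: rhom_ext => x n; apply: rhom_ext.
Defined.

End RightAdjunction.

Theorem proposition3p14 (k : comPzRingType) (X : Type) (T : monad k X)
    (J : left_ideal T) :
  inhabited (adjunction
    (tensorL_functor (quotient_bimodule J)
       : functor (LMod (eigenmonad J)) (LMod T))
    (homL_functor (quotient_bimodule J)
       : functor (LMod T) (LMod (eigenmonad J))))
  /\
  inhabited (adjunction
    (tensorR_functor (quotient_bimodule J)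
       : functor (RMod T) (RMod (eigenmonad J)))
    (homR_functor (quotient_bimodule J)
       : functor (RMod (eigenmonad J)) (RMod T))).
Proof.
(* An adjunction is data; [constructor] turns it into a proof of [inhabited], with [B] taken to be
   [T/J]. *)
by split; constructor;
  [apply: tensorL_homL_adjunction | apply: tensorR_homR_adjunction].
Qed.
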